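(* There exists a constant $\widetilde C$ such that for every integer $n\geq 2$, $$\sup_{x\in[0,1]}\left|\frac{\ln(\phi_n(x))}{n\ln n}-\sqrt{1-x}\right|\leq \frac{\widetilde C}{\ln n},$$ where $\phi_n:[0,1]\to\mathbb{R}$ is defined by $\phi_n(x)=\mathcal{C}(n,1)=(n-1)!$ if $x<\frac{6}{n(n+1)}$; otherwise $\phi_n(x)=\mathcal{C}\!\left(n,\frac{n(n+1)}{2}\right)=1$ if $x\geq 1-\frac{2}{n(n+1)}$; and $\phi_n(x)=\mathcal{C}\!\left(n,\left[\frac{n(n+1)}{2}x\right]\right)$ in all other cases, $[y]$ denoting the integer part of $y$.
   Context: For a permutation $\sigma=a_1a_2\cdots a_n$ of $\{1,\dots,n\}$ (in one-line notation), position $j$ is a record position of $\sigma$ if $a_i<a_j$ for all $i<j$ (so position $1$ is always a record position). For integers $n\geq 1$ and $k$, $\mathcal{C}(n,k)$ denotes the number of permutations of $\{1,\dots,n\}$ for which the sum of the record positions equals $k$; equivalently, $\mathcal{C}(n,k)$ is the coefficient of $q^k$ in $q(q^2+1)(q^3+2)\cdots(q^n+n-1)$. *)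

(* Defs.v *)
From HB Require Import structures.
From mathcomp Require Import all_boot all_order all_algebra all_fingroup.
From mathcomp Require Import all_classical all_reals all_analysis.
Set Implicit Arguments.
Unset Strict Implicit.
Unset Printing Implicit Defensive.
Import Order.TTheory GRing.Theory Num.Theory.
Local Open Scope ring_scope.

(* 'S_n permutes {0, ..., n-1}; the 1-based position of j : 'I_n is j.+1.
   Shifting the values by one as well does not affect the records. *)
Definition is_record (n : nat) (s : 'S_n) (j : 'I_n) : bool :=
  [forall i : 'I_n, (i < j)%N ==> (s i < s j)%N].

Definition record_sum (n : nat) (s : 'S_n) : nat :=
  (\sum_(j < n | is_record s j) j.+1)%N.

Definition Cnum (n : nat) (k : int) : nat :=
  #|[set s : 'S_n | (record_sum s)%:Z == k]|.

(* Only the values at x in [0, 1] are meaningful. *)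
Definition phi (R : realType) (n : nat) (x : R) : R :=
  if x < 6 / (n * n.+1)%N%:R then (Cnum n 1)%:R
  else if 1 - 2 / (n * n.+1)%N%:R <= x then (Cnum n (n * n.+1 %/ 2)%N%:Z)%:R
  else (Cnum n (Num.floor ((n * n.+1)%N%:R / 2 * x)))%:R.

(* Main.v *)
(* Choosing the non-record positions one by one shows that C(n, k) is the sum,
   over the sets T of integers in [2, n] whose sum is m = n(n+1)/2 - k, of the
   product of the j - 1 for j in T. Let t be maximal with
   t(t+1)/2 <= m + 1, so that t = n sqrt(1-x) + O(1). Every such T has at most t
   elements, hence C(n, k) <= 2^n n^t; and a small perturbation of {2, ..., t}
   has sum m and weight at least (t-1)! >= n^(t-1) / 4^n. Hence
   ln C(n, k) = t ln n + O(n). *)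

Require Import Defs.
From HB Require Import structures.
From mathcomp Require Import all_boot all_order all_algebra all_fingroup.
From mathcomp Require Import all_classical all_reals all_analysis.
From mathcomp Require Import zify ring lra.
Import Order.TTheory GRing.Theory Num.Theory.
Local Open Scope classical_set_scope.
Local Open Scope ring_scope.

(** * Permutations split by their last value *)

(** The last value and the pattern of the others determine a permutation; injectivity and equal
    cardinals make this a bijection. *)
Lemma big_lift_perm_max {T : Type} {idx : T} {op : Monoid.com_law idx}
    (n : nat) (F : 'S_n.+1 -> T) :
  \big[op/idx]_s F s =
  \big[op/idx]_(i < n.+1) \big[op/idx]_(s : 'S_n) F (lift_perm ord_max i s).
Proof.
pose h (p : 'I_n.+1 * 'S_n) : 'S_n.+1 := lift_perm ord_max p.1 p.2.
have h_inj : injective h.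
  move=> [i s] [j t]; rewrite /h /= => hst.
  have ij : i = j by rewrite -(lift_perm_id ord_max i s) hst lift_perm_id.
  rewrite -ij in hst *; congr (_, _); apply/permP => k.
  by apply: (@lift_inj _ i); rewrite -!(lift_perm_lift ord_max) hst.
have h_bij : bijective h.
  by apply: inj_card_bij => //; rewrite card_prod !card_Sn card_ord factS.
rewrite (reindex h); last exact: onW_bij.
by rewrite pair_big.
Qed.

Lemma ltn_lift (n : nat) (i : 'I_n.+1) (j k : 'I_n) :
  (lift i j < lift i k)%N = (j < k)%N.
Proof. by rewrite /= ltnNge leq_bump2 -ltnNge. Qed.

Lemma record_lift_perm (n : nat) (i : 'I_n.+1) (s : 'S_n) (j : 'I_n) :
  is_record (lift_perm ord_max i s) (lift ord_max j) = is_record s j.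
Proof.
apply/forallP/forallP => rec k.
  by have := rec (lift ord_max k); rewrite !lift_perm_lift !ltn_lift.
case: (unliftP ord_max k) => [l|] ->; first by rewrite !lift_perm_lift !ltn_lift.
by rewrite lift_max ltnNge ltnW //= ltn_ord.
Qed.

Lemma record_lift_perm_max (n : nat) (i : 'I_n.+1) (s : 'S_n) :
  is_record (lift_perm ord_max i s) ord_max = (i == ord_max).
Proof.
apply/forallP/eqP => [rec | -> k].
  apply/eqP; apply: contraT => /negPf ineq.
  case: (unliftP i ord_max) => [j jE | iE]; last by rewrite iE eqxx in ineq.
  (* This earlier position carries the top value. *)
  have /implyP := rec (lift ord_max (s^-1%g j)).
  rewrite lift_max ltn_ord lift_perm_lift permKV -jE lift_perm_id => /(_ isT).
  by rewrite ltnNge /= -ltnS ltn_ord.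
apply/implyP; case: (unliftP ord_max k) => [l|] ->; last by rewrite ltnn.
by rewrite lift_perm_id lift_perm_lift !lift_max !ltn_ord.
Qed.

Lemma record_sum_lift_perm (n : nat) (i : 'I_n.+1) (s : 'S_n) :
  record_sum (lift_perm ord_max i s) =
  (record_sum s + (i == ord_max) * n.+1)%N.
Proof.
rewrite /record_sum big_mkcond big_ord_recr /= record_lift_perm_max.
congr addn; last by case: (i == ord_max); rewrite ?mul1n ?mul0n.
rewrite [RHS]big_mkcond; apply: eq_bigr => j _.
have -> : widen_ord (leqnSn n) j = lift ord_max j.
  by apply: val_inj; rewrite [RHS]lift_max.
by rewrite record_lift_perm.
Qed.

Lemma record_sum_le (n : nat) (s : 'S_n) : (record_sum s <= 'C(n.+1, 2))%N.
Proof.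
rewrite /record_sum big_mkcond -triangular_sum big_mkord.
rewrite big_ord_recl add0n.
by apply: leq_sum => j _; case: ifP.
Qed.

(* Counting by the sum [m] of the non-record positions (1-based) keeps
   the recurrence free of [n(n+1)/2] and of negative indices. *)
Definition nonrecord_count (n m : nat) : nat :=
  (\sum_(s : 'S_n) (record_sum s + m == 'C(n.+1, 2)))%N.

(** The last position is a record only under the top value; each of its [n] other values adds [n+1]
    to the non-record sum. *)
Lemma nonrecord_countS (n m : nat) :
  nonrecord_count n.+1 m =
  (nonrecord_count n m + if m < n.+1 then 0
                         else n * nonrecord_count n (m - n.+1))%N.
Proof.
have binE : 'C(n.+2, 2) = ('C(n.+1, 2) + n.+1)%N by rewrite binS bin1.
rewrite /nonrecord_count big_lift_perm_max big_ord_recr /= addnC binE.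
congr addn.
  apply: eq_bigr => s _; rewrite record_sum_lift_perm eqxx mul1n.
  by congr (nat_of_bool _); lia.
transitivity (\sum_(i < n) \sum_(s : 'S_n)
    (record_sum s + m == 'C(n.+1, 2) + n.+1))%N.
  apply: eq_bigr => i _; apply: eq_bigr => s _; rewrite record_sum_lift_perm.
  have -> : (widen_ord (leqnSn n) i == ord_max) = false.
    by apply/eqP => /(congr1 val) /=; have := ltn_ord i; lia.
  by rewrite mul0n addn0.
rewrite sum_nat_const card_ord; case: ltnP => hm.
  rewrite big1 ?muln0 // => s _.
  by have := record_sum_le n s; case: eqP => //; lia.
by congr muln; apply: eq_bigr => s _; congr (nat_of_bool _); lia.
Qed.

Lemma nonrecord_count_le_fact (n m : nat) : (nonrecord_count n m <= n`!)%N.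
Proof.
rewrite -card_Sn -sum1_card.
by apply: leq_sum => s _; exact: leq_b1.
Qed.

Lemma nonrecord_count_mono (n p m : nat) :
  (n <= p)%N -> (nonrecord_count n m <= nonrecord_count p m)%N.
Proof.
move=> /subnK <-; elim: (p - n)%N => [//|k IH].
by rewrite addSn nonrecord_countS (leq_trans IH) // leq_addr.
Qed.

Lemma nonrecord_count_mul (n m : nat) :
  (n * nonrecord_count n m <= nonrecord_count n.+1 (m + n.+1))%N.
Proof. by rewrite nonrecord_countS ltnNge leq_addl /= addnK leq_addl. Qed.

(** * Upper bound on the counts *)

Lemma fact_le_exp (n : nat) : (n`! <= n ^ n)%N.
Proof.
elim: n => // n IH; rewrite factS expnS leq_mul2l /=.
by rewrite (leq_trans IH) //; case: n {IH} => // n; rewrite leq_exp2r.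
Qed.

(* At most [t] non-record positions fit in a sum [m < (t+1)(t+2)/2], and each
   contributes a factor below [b]; [2 ^ n] counts the sets of positions. *)
Lemma nonrecord_count_le (b n m t : nat) :
  (0 < b)%N -> (n <= b)%N -> (m.+1.*2 < t.+1 * t.+2)%N ->
  (nonrecord_count n m <= 2 ^ n * b ^ t)%N.
Proof.
move=> b_gt0; elim: n m t => [|n IH] m t hnb hm.
  by rewrite mul1n (leq_trans (nonrecord_count_le_fact _ _)) // expn_gt0 b_gt0.
case: (ltnP n t) => [hnt | htn].
  apply: leq_trans (nonrecord_count_le_fact _ _) _.
  apply: leq_trans (fact_le_exp _) _.
  apply: (@leq_trans (b ^ n.+1)); first by rewrite leq_exp2r.
  by rewrite (leq_trans (leq_pexp2l b_gt0 hnt)) // leq_pmull // expn_gt0.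
rewrite nonrecord_countS expnS -mulnA mul2n -addnn.
apply: leq_add; first by apply: IH => //; exact: ltnW.
(* As [t <= n], taking [n+1] out of [m] lowers the bound [(t+1)(t+2)] on [2(m+1)] to [t(t+1)], so
   [t] drops by one. *)
case: ltnP => // hmn; case: t htn hm => [|t] htn hm; first by lia.
rewrite expnS mulnCA; apply: leq_mul; first exact: ltnW.
by apply: IH; [exact: ltnW | nia].
Qed.

(** * Lower bound on the counts *)

(** The set [{2, ..., a+1}] has sum [a(a+3)/2] and weight [a!]. *)
Lemma nonrecord_count_triangle (a m : nat) :
  m.*2 = (a * a.+3)%N -> (a`! <= nonrecord_count a.+1 m)%N.
Proof.
elim: a m => [|a IH] m hm.
  have -> : m = 0%N by lia.
  rewrite nonrecord_countS addn0 /nonrecord_count.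
  rewrite (eq_bigr (fun=> 1%N)) ?sum1_card ?card_Sn // => s _.
  by rewrite /record_sum big_ord0.
have -> : m = (m - a.+2 + a.+2)%N by nia.
apply: leq_trans (nonrecord_count_mul _ _).
by rewrite factS leq_mul2l IH // ; nia.
Qed.

(* The set [{2, ..., a+2}] with [a+2-d] removed. *)
Lemma nonrecord_count_gap (d a m : nat) :
  (d <= a)%N -> m.*2 = (a * a.+3 + d.*2)%N ->
  (a`! <= nonrecord_count a.+2 m)%N.
Proof.
elim: d a m => [|d IH] a m hd hm.
  (* For [d = 0] the removed element is the largest, which leaves [{2, ..., a+1}]. *)
  apply: leq_trans (nonrecord_count_mono _ _ _ (leqnSn _)).
  by apply: nonrecord_count_triangle; lia.
case: a hd hm => // a hd hm.
have -> : m = (m - a.+3 + a.+3)%N by nia.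
apply: leq_trans (nonrecord_count_mul _ _).
by rewrite factS leq_mul // IH //; nia.
Qed.

(* The set [{3, ..., a+2, a+4}]. *)
Lemma nonrecord_count_skip (a m : nat) :
  m.*2 = (a.+1 * a.+4 + a.+2.*2)%N -> (a.+1`! <= nonrecord_count a.+4 m)%N.
Proof.
move=> hm; have -> : m = (m - a.+4 + a.+4)%N by nia.
apply: leq_trans (nonrecord_count_mul _ _).
rewrite factS; apply: leq_mul; first by lia.
apply: leq_trans (nonrecord_count_mono _ _ _ (leqnSn _)).
(* With [d = a] the removed element is 2. *)
by apply: (@nonrecord_count_gap a) => //; nia.
Qed.

(* The excluded sums [1] and [n(n+1)/2 - 2] are not attained; [a] is [t - 1] in
   the notation of the header. *)
Lemma nonrecord_count_ge (n m a : nat) :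
  m != 1%N -> (m.+1.*2 <= n * n.+1)%N -> (m.+2.*2 != n * n.+1)%N ->
  (a.+1 * a.+2 <= m.+1.*2)%N -> (m.+1.*2 < a.+2 * a.+3)%N ->
  (a`! <= nonrecord_count n m)%N.
Proof.
move=> m_neq1 m_le m_neq lo hi.
(* [d] is the excess of [m] over the sum of [{2, ..., a+1}]. *)
have [d hd] : exists d, (m.*2 = a * a.+3 + d.*2)%N.
  exists (m - (a * a.+3)./2)%N.
  have e : ((a * a.+3)./2.*2 = a * a.+3)%N.
    by rewrite even_halfK // oddM /= negbK; case: (odd a).
  by lia.
have {hi} d_le : (d <= a.+1)%N by nia.
case: d d_le hd => [|d] d_le hd.
  apply: (leq_trans (@nonrecord_count_triangle a m _)); first by lia.
  by apply: nonrecord_count_mono; nia.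
case: (ltnP d a) => [da | ad].
  apply: (leq_trans (@nonrecord_count_gap d.+1 a m da hd)).
  by apply: nonrecord_count_mono; nia.
(* Now [m] is one less than the sum of [{2, ..., a+2}], which has no element 1 to remove. Here
   [a = 0] would force [m = 1], and [n = a+2] would force [m = n(n+1)/2 - 2]; otherwise [a+3] is
   available. *)
have {ad d_le} dE : d = a by lia.
case: a lo dE hd => [|a] lo dE hd; first by lia.
apply: (leq_trans (@nonrecord_count_skip a m _)); first by lia.
apply: nonrecord_count_mono; rewrite leqNgt; apply/negP => n_lt.
have : n = a.+3 \/ (n <= a.+2)%N by lia.
by case=> [nE|]; [rewrite nE in m_neq; nia | nia].
Qed.

Lemma bin_le_exp2 (n m : nat) : ('C(n, m) <= 2 ^ n)%N.
Proof.
elim: n m => [|n IH] [|m]; rewrite ?bin0 ?expn_gt0 //.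
by rewrite binS expnS mul2n -addnn leq_add.
Qed.

(** The product [(n+1)...(n+a)] dominates [n^a] and equals ['C(n+a, a) * a!]. This replaces
    Stirling's formula. *)
Lemma expn_le_fact (n a : nat) : (n ^ a <= 2 ^ (n + a) * a`!)%N.
Proof.
apply: (@leq_trans ((n + a) ^_ a)).
  elim: a => // a IH; rewrite expnS addnS ffactSS leq_mul //.
  by rewrite leqW // leq_addr.
by rewrite -bin_ffact leq_mul // bin_le_exp2.
Qed.

(** * From [phi] to non-record counts *)

Lemma Cnum_nonrecord (n m : nat) : (m <= 'C(n.+1, 2))%N ->
  Cnum n ('C(n.+1, 2) - m)%N%:Z = nonrecord_count n m.
Proof.
move=> hm; rewrite /Cnum -sum1dep_card big_mkcond; apply: eq_bigr => s _.
rewrite eqz_nat.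
have -> : (record_sum s + m == 'C(n.+1, 2))%N =
          (record_sum s == 'C(n.+1, 2) - m)%N by lia.
by case: eqP.
Qed.

Lemma triangleE (n : nat) : (n * n.+1 = ('C(n.+1, 2)).*2)%N.
Proof. by rewrite mulnC bin2 /= even_halfK // oddM /= andNb. Qed.

(* The exceptional clauses of [phi] are exactly those that avoid the empty
   coefficients [k = 2] and [k = n(n+1)/2 - 1]. *)
Lemma phi_nonrecord (R : realType) (n : nat) (x : R) :
  (2 <= n)%N -> 0 <= x <= 1 ->
  exists m : nat,
    [/\ phi n x = (nonrecord_count n m)%:R, m != 1%N,
        (m.+2.*2 != n * n.+1)%N, (m.+1.*2 <= n * n.+1)%N &
        (n * n.+1)%N%:R * (1 - x) <= 2 * m.+1%:R :> R /\
        2 * m%:R <= (n * n.+1)%N%:R * (1 - x) + 4 :> R].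
Proof.
move=> n_ge2 /andP[x_ge0 x_le1]; rewrite /phi.
have NE := triangleE n; set N := 'C(n.+1, 2) in NE.
have N_ge3 : (3 <= N)%N by nia.
have MR : (n * n.+1)%N%:R = 2 * N%:R :> R by rewrite NE -mul2n natrM.
have NR : 3 <= N%:R :> R by rewrite ler_nat.
have M_gt0 : 0 < 2 * N%:R :> R by lra.
rewrite !MR.
case: ifPn => [|].
  rewrite ltr_pdivlMr // => x_lt; exists (N - 1)%N.
  have -> : 1 = (N - (N - 1))%N%:Z by lia.
  have e : (N - 1)%N%:R = N%:R - 1 :> R by rewrite natrB //; lia.
  split; [by rewrite Cnum_nonrecord // leq_subr | lia | lia | lia |].
  (* The slack 4 comes from this case, where [2 N x] can be close to 6. *)
  by rewrite -natr1 e; split; nra.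
rewrite -leNgt ler_pdivrMr // => x_ge.
case: ifPn => [|].
  rewrite lerBlDr -lerBlDl ler_pdivlMr // => x_le; exists 0%N.
  have -> : (n * n.+1 %/ 2 = N - 0)%N by rewrite NE; lia.
  split; [by rewrite Cnum_nonrecord | lia | lia | lia |].
  by split; nra.
rewrite -ltNge ltrBrDr -ltrBrDl ltr_pdivrMr // => x_lt.
have -> : 2 * N%:R / 2 * x = N%:R * x by field.
have /andP[lo hi] := floor_itv (N%:R * x).
set k := Num.floor _ in lo hi *.
have k_ge3 : 3 <= k by rewrite floor_ge_int /=; nra.
have k_lt : k < N%:Z - 1 by rewrite floor_lt_int rmorphB /=; nra.
have [l kE] : exists l : nat, k = l%:Z by exists `|k|%N; lia.
rewrite kE in lo hi k_ge3 k_lt *.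
have -> : l = (N - (N - l))%N by lia.
have e : (N - l)%N%:R = N%:R - l%:R :> R by rewrite natrB //; lia.
have hi' : N%:R * x < l%:R + 1 by move: hi; rewrite intrD.
have lo' : l%:R <= N%:R * x by [].
exists (N - l)%N.
split; [by rewrite Cnum_nonrecord // leq_subr | lia | lia | lia |].
by rewrite -natr1 e; split; lra.
Qed.

(** * Logarithmic estimates *)

Lemma ln2_le1 (R : realType) : ln 2 <= 1 :> R.
Proof. by apply: le_ln1Dx; lra. Qed.

Lemma ln_nonrecord_count_le (R : realType) (n m t : nat) :
  (0 < n)%N -> (0 < nonrecord_count n m)%N -> (m.+1.*2 < t.+1 * t.+2)%N ->
  ln (nonrecord_count n m)%:R <= n%:R + t%:R * ln n%:R :> R.
Proof.
move=> n_gt0 D_gt0 hm.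
have nR : 0 < n%:R :> R by rewrite ltr0n.
have : (nonrecord_count n m)%:R <= 2 ^+ n * n%:R ^+ t :> R.
  by rewrite -!natrX -natrM ler_nat nonrecord_count_le.
rewrite -ler_ln ?posrE ?mulr_gt0 ?exprn_gt0 ?ltr0n // => /le_trans; apply.
rewrite lnM ?posrE ?exprn_gt0 // !lnXn // lerD ?mulr_natl //.
by rewrite lerMn2r ln2_le1 orbT.
Qed.

Lemma ln_fact_ge (R : realType) (n a : nat) :
  (0 < n)%N -> (a <= n)%N ->
  a%:R * ln n%:R - 2 * n%:R <= ln a`!%:R :> R.
Proof.
move=> n_gt0 a_le.
have nR : 0 < n%:R :> R by rewrite ltr0n.
have aR : a%:R <= n%:R :> R by rewrite ler_nat.
have : n%:R ^+ a <= 2 ^+ (n + a) * a`!%:R :> R.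
  by rewrite -!natrX -natrM ler_nat expn_le_fact.
rewrite -ler_ln ?posrE ?mulr_gt0 ?exprn_gt0 ?ltr0n ?fact_gt0 //.
rewrite lnM ?posrE ?exprn_gt0 ?ltr0n ?fact_gt0 // !lnXn //.
have : ln 2 *+ (n + a) <= n%:R + a%:R :> R.
  by rewrite -natrD lerMn2r ln2_le1 orbT.
by rewrite -mulr_natl; lra.
Qed.

Lemma triangular_root (m : nat) :
  exists t : nat, (t * t.+1 <= m < t.+1 * t.+2)%N.
Proof.
elim: m => [|m [t /andP[lo hi]]]; first by exists 0%N.
case: (ltnP m.+1 (t.+1 * t.+2)) => h; first by exists t; lia.
by exists t.+1; nia.
Qed.

Lemma ln_phi_bound (R : realType) (n : nat) (x : R) :
  (2 <= n)%N -> 0 <= x <= 1 ->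
  `|ln (phi n x) - n%:R * ln n%:R * Num.sqrt (1 - x)| <= 5 * n%:R.
Proof.
move=> n_ge2 x01.
have n_gt0 : (0 < n)%N by exact: ltnW.
have [m [-> m1 mN m_le [loR hiR]]] := phi_nonrecord R n x n_ge2 x01.
(* The root is [t = a + 1], nonzero because [2(m+1) >= 2]. *)
have [[|a] /andP[lo hi]] := triangular_root m.+1.*2; first by lia.
have a_lt : (a < n)%N by nia.
have D_ge := nonrecord_count_ge n m a m1 m_le mN lo hi.
have D_gt0 := leq_trans (fact_gt0 a) D_ge.
have ub := @ln_nonrecord_count_le R _ _ _ n_gt0 D_gt0 hi.
have lb := @ln_fact_ge R _ _ n_gt0 (ltnW a_lt).
have {}D_ge : ln a`!%:R <= ln (nonrecord_count n m)%:R :> R.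
  by rewrite ler_ln ?posrE ?ltr0n ?fact_gt0 // ler_nat.
have sE : Num.sqrt (1 - x) ^+ 2 = 1 - x by rewrite sqr_sqrtr //; lra.
have s_ge0 : 0 <= Num.sqrt (1 - x) := sqrtr_ge0 _.
set s := Num.sqrt _ in sE s_ge0 *.
have s_le1 : s <= 1 by nra.
have nR : 2 <= n%:R :> R by rewrite ler_nat.
have L_ge0 : 0 <= ln n%:R :> R by rewrite ln_ge0 //; lra.
have L_le : ln n%:R <= n%:R :> R by rewrite ltW // ln_sublinear //; lra.
have loR' : a.+1%:R * a.+2%:R <= 2 * m.+1%:R :> R.
  by rewrite -!natrM ler_nat mul2n.
have hiR' : 2 * m.+1%:R <= a.+2%:R * a.+3%:R :> R.
  by rewrite -!natrM ler_nat mul2n ltnW.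
rewrite -sE natrM -natr1 in loR hiR.
have aR : 0 <= a%:R :> R by [].
rewrite -!natr1 in loR loR' hiR' ub.
set L := ln n%:R in L_ge0 L_le ub lb *.
set N := n%:R in nR L_le ub lb loR hiR *.
set A := a%:R in aR ub lb loR' hiR' *.
(* Squared: [(N s)^2 <= N(N+1) s^2 <= 2(m+1) <= (A+2)(A+3)]. *)
have a_ge : N * s <= A + 3.
  rewrite -(ler_pXn2r (_ : 0 < 2)%N) ?nnegrE //; nra.
(* Squared: [(A+1)(A+2) <= 2(m+1) <= N(N+1) s^2 + 6]. *)
have a_le : A + 1 <= (N + 1) * s + 3.
  rewrite -(ler_pXn2r (_ : 0 < 2)%N) ?nnegrE //; nra.
(* The error is at most [N + 4 L] above and [2 N + 3 L] below; [L <= N] turns both into at most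
   [5 N]. *)
have up : (A + 1) * L <= ((N + 1) * s + 3) * L by rewrite ler_wpM2r.
have dn : N * s * L <= (A + 3) * L by rewrite ler_wpM2r.
have sL : s * L <= L by rewrite ler_piMl.
rewrite ler_norml; apply/andP; split; nra.
Qed.

Theorem theorem4p1 (R : realType) :
  exists C : R, forall n : nat, (2 <= n)%N ->
    (ereal_sup [set (`| ln (phi n x) / (n%:R * ln n%:R) - Num.sqrt (1 - x) |)%:E
               | x in `[0%R, 1%R]%classic]
     <= (C / ln n%:R)%:E)%E.
Proof.
exists 5 => n n_ge2; apply: ge_ereal_sup => _ [x /= x01 <-].
rewrite in_itv /= in x01.
have n_gt0 : 0 < n%:R :> R by rewrite ltr0n ltnW.
have L_gt0 : 0 < ln n%:R :> R by rewrite ln_gt0 // ltr1n.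
have nL_gt0 : 0 < n%:R * ln n%:R :> R by exact: mulr_gt0.
rewrite lee_fin.
have -> : ln (phi n x) / (n%:R * ln n%:R) - Num.sqrt (1 - x) =
  (ln (phi n x) - n%:R * ln n%:R * Num.sqrt (1 - x)) / (n%:R * ln n%:R).
  by field; rewrite !gt_eqF.
rewrite normrM normfV (gtr0_norm nL_gt0) ler_pdivrMr //.
apply: le_trans (ln_phi_bound R n x n_ge2 x01) _.
by rewrite le_eqVlt; apply/orP; left; apply/eqP; field; rewrite gt_eqF.
Qed.
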